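(* Let $G$ be a non-periodic group and let $A$ be an infinite set. Then there exists a cellular automaton $\tau' \colon A^G \to A^G$ such that $\tau'(A^G)$ is not closed in $A^G$ with respect to the prodiscrete topology.
   Context: A group is periodic if all its elements have finite order; it is non-periodic otherwise. For a group $G$ and a set $A$, $A^G$ denotes the set of all maps $x \colon G \to A$, with left $G$-action (the shift) given by $(gx)(h) = x(g^{-1}h)$ for $g,h \in G$, $x \in A^G$. A cellular automaton over the group $G$ and the alphabet $A$ is a map $\tau \colon A^G \to A^G$ for which there exist a finite subset $M \subset G$ and a map $\mu \colon A^M \to A$ such that $\tau(x)(g) = \mu(\pi_M(g^{-1}x))$ for all $x \in A^G$ and $g \in G$, where $\pi_M \colon A^G \to A^M$ is the restriction map. The prodiscrete topology on $A^G$ is the product topology obtained by taking the discrete topology on each factor $A$ of $A^G$. *)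

(* Defs.v *)
From mathcomp Require Import all_boot.
From mathcomp Require Import all_classical all_analysis.

Set Implicit Arguments.
Unset Strict Implicit.
Unset Printing Implicit Defensive.

Local Open Scope classical_set_scope.
Local Open Scope group_scope.

Definition has_finite_order (G : groupType) (g : G) : Prop :=
  exists n : nat, (0 < n)%N /\ g ^+ n = 1.

Definition periodic_group (G : groupType) : Prop :=
  forall g : G, has_finite_order g.

(* A^G with its prodiscrete topology *)
Definition config (G : groupType) (A : choiceType) : Type :=
  {ptws G -> discrete_topology A}.

Definition config_shift (G : groupType) (A : choiceType) (g : G)
    (x : config G A) : config G A :=
  fun h => x (g^-1 * h).

(* The subset M is used as the subtype of its elements, so that M -> A is A^M,
   and [sigL M] is the restriction map from A^G to A^M. *)
Definition cellular_automaton (G : groupType) (A : choiceType)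
    (tau : config G A -> config G A) : Prop :=
  exists (M : set G) (mu : (M -> A) -> A),
    finite_set M /\
    forall (x : config G A) (g : G),
      tau x g = mu (sigL M (config_shift g^-1 x)).

(* Main.v *)
Require Import Defs.
From mathcomp Require Import all_boot.
From mathcomp Require Import all_classical all_analysis.

(** Let t have infinite order, and let [rank] map the alphabet onto the natural
    numbers.  The automaton [descent] answers at g whether the rank of x drops
    strictly from g to g t.  The configuration answering yes everywhere has no
    preimage, since a preimage would give an infinite descending chain of
    naturals along 1, t, t^2, ... ([no_preimage]).  But on any given finite set
    E it agrees with some output ([finite_descent]): let x g have as rank the
    number of elements of E of the form g t^n with n a natural number.  Passing
    from g in E to g t loses g itself, because t has infinite order
    ([ray_count_decreases]).  A closed set contains every configuration that
    its members match on each finite set ([closed_of_finite_agreement]), so the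
    image is not closed. *)

Local Open Scope group_scope.
Local Open Scope classical_set_scope.

(** The sets of configurations agreeing with [y] on a finite set generate a
    filter converging to [y]: convergence in a product is checked one coordinate
    at a time, and there the one-point set [[:: i]] is enough. *)
Lemma closed_of_finite_agreement (I A : choiceType)
    (C : set {ptws I -> discrete_topology A})
    (y : {ptws I -> discrete_topology A}) :
  closed C ->
  (forall E : seq I, exists2 z, C z & (forall i, i \in E -> z i = y i)) -> C y.
Proof.
move=> clC approx; apply: clC => B By.
pose agree (E : seq I) : set {ptws I -> discrete_topology A} :=
  [set z | forall i, i \in E -> z i = y i].
pose F := filter_from [set: seq I] agree.
have FF : Filter F.
  apply: filter_from_filter; first by exists [::].
  move=> E1 E2 _ _; exists (E1 ++ E2) => // z zE.
  by split=> i iE; apply: zE; rewrite mem_cat iE ?orbT.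
have Fy : F --> y.
  apply/cvg_sup => i U [_ [[W _ <-] /= Wyi] WU].
  exists [:: i] => // z zi; apply: WU.
  by rewrite /= zi ?mem_head.
have [E _ EB] : F B := Fy _ By.
by have [z Cz zE] := approx E; exists z; split=> //; apply: EB.
Qed.

Definition ray {G : groupType} (t g : G) : pred G :=
  fun f => `[< exists n : nat, f = g * t ^+ n >].

(** The ray from [g * t] lies inside the ray from [g], and misses [g]: otherwise
    [t ^+ n.+1 = 1] for some [n]. *)
Lemma ray_count_decreases (G : groupType) (t g : G) (E : seq G) :
  ~ has_finite_order t -> g \in E ->
  (count (ray t (g * t)%g) E < count (ray t g) E)%N.
Proof.
move=> t_inf gE.
have sub : subpred (ray t (g * t)) (ray t g).
  move=> f /asboolP[n ->]; apply/asboolP; exists n.+1.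
  by rewrite expgS mulgA.
have gg : ray t g g by apply/asboolP; exists 0%N; rewrite expg0 mulg1.
have gNgt : ~~ ray t (g * t) g.
  apply/asboolPn => -[n gE']; apply: t_inf; exists n.+1; split=> //.
  by apply: (mulgI g); rewrite mulg1 expgS mulgA -gE'.
rewrite !(permP (perm_to_rem gE)) /= gg (negbTE gNgt) add0n add1n ltnS.
exact: sub_count.
Qed.

Lemma no_infinite_descent (u : nat -> nat) : ~ (forall n, (u n.+1 < u n)%N).
Proof.
move=> dec.
have bound n : (u n + n <= u 0)%N.
  elim: n => [|n IHn]; first by rewrite addn0.
  by apply: leq_trans IHn; rewrite addnS -addSn leq_add2r dec.
have := leq_trans (leq_addl _ _) (bound (u 0).+1).
by rewrite ltnn.
Qed.

Lemma infinite_encodes_nat (A : Type) : infinite_set [set: A] ->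
  exists (enc : nat -> A) (rank : A -> nat), cancel enc rank.
Proof.
move=> /infiniteP/pcard_surjP[rank rank_surj].
have fibre n : exists a, rank a = n by have [a _ <-] := rank_surj n I; exists a.
have [enc encK] := choice fibre.
by exists enc, rank.
Qed.

Definition descent {G : groupType} {A : choiceType} (t : G) (rank : A -> nat)
    (yes no : A) (x : config G A) : config G A :=
  fun g => if (rank (x (g * t)%g) < rank (x g))%N then yes else no.

Lemma descent_cellular (G : groupType) (A : choiceType) (t : G)
    (rank : A -> nat) (yes no : A) :
  cellular_automaton (descent t rank yes no).
Proof.
pose M : set G := [set 1; t].
have M1 : 1 \in M by rewrite inE; left.
have Mt : t \in M by rewrite inE; right.
exists M, (fun z : M -> A =>
  if (rank (z (SigSub Mt)) < rank (z (SigSub M1)))%N then yes else no).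
split; first exact: finite_set2.
by move=> x g; rewrite /descent /sigL /config_shift /= !invgK mulg1.
Qed.

Lemma no_preimage (G : groupType) (A : choiceType) (t : G)
    (rank : A -> nat) (yes no : A) :
  no <> yes -> forall x, descent t rank yes no x <> (fun=> yes).
Proof.
move=> noNyes x xE; apply: (no_infinite_descent (fun n => rank (x (t ^+ n)))).
move=> n; have := congr1 (@^~ (t ^+ n)) xE.
by rewrite /descent -expgSr; case: ifP.
Qed.

Lemma finite_descent (G : groupType) (A : choiceType) (t : G)
    (rank : A -> nat) (yes no : A) (enc : nat -> A) (E : seq G) :
  cancel enc rank -> ~ has_finite_order t ->
  exists x, forall g, g \in E -> descent t rank yes no x g = yes.
Proof.
move=> encK t_inf; exists (fun g => enc (count (ray t g) E)) => g gE.
by rewrite /descent !encK ray_count_decreases.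
Qed.

Theorem corollary1p6 (G : groupType) (A : choiceType)
    (hG : ~ periodic_group G) (hA : infinite_set [set: A]) :
  exists tau' : config G A -> config G A,
    cellular_automaton tau' /\ ~ closed (tau' @` [set: config G A]).
Proof.
have [t t_inf] : exists t : G, ~ has_finite_order t by apply/existsNP.
have [enc [rank encK]] := infinite_encodes_nat _ hA.
exists (descent t rank (enc 0%N) (enc 1%N)); split.
  exact: descent_cellular.
move=> cl.
have [|x _] := closed_of_finite_agreement _ _ _ (fun=> enc 0%N) cl.
  move=> E.
  have [x xE] := finite_descent _ _ _ _ (enc 0%N) (enc 1%N) _ E encK t_inf.
  by exists (descent t rank (enc 0%N) (enc 1%N) x) => //; exists x.
by apply: no_preimage => /(can_inj encK).
Qed.
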